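(* Let $A$ be an algebra, let $\mathcal{M}$ be an essentially reductive Hilbert module over $A$, let $\mathcal{N}$ be a (closed) submodule of $\mathcal{M}$, and let $\mathcal{Q}=\mathcal{M}/\mathcal{N}$ be the corresponding quotient module. Then $\mathcal{N}$ is essentially reductive if and only if $\mathcal{Q}$ is essentially reductive.
   Context: A Hilbert module over a complex algebra $A$ is a complex Hilbert space $\mathcal{M}$ that is a module over $A$ such that for each $\varphi\in A$ the module multiplication $M_\varphi f=\varphi\cdot f$ is a bounded operator on $\mathcal{M}$. A submodule is a closed subspace $\mathcal{N}$ invariant under all $M_\varphi$. The quotient module $\mathcal{M}/\mathcal{N}$ carries the quotient Hilbert space norm and the induced action; equivalently it is $\mathcal{N}^\perp$ with $\varphi$ acting as the compression of $M_\varphi$ to $\mathcal{N}^\perp$. A Hilbert module $\mathcal{M}$ is essentially reductive if for every $\varphi\in A$ the self-commutator $[M_\varphi^*,M_\varphi]=M_\varphi^*M_\varphi-M_\varphi M_\varphi^*$ is a compact operator on $\mathcal{M}$. *)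

(* Defs.v *)
From HB Require Import structures.
From mathcomp Require Import all_boot all_order all_algebra.
From mathcomp Require Import sesquilinear complex.
From mathcomp Require Import boolp classical_sets functions filter reals.
From mathcomp Require Import topology normedtype ring lra.
Set Implicit Arguments.
Unset Strict Implicit.
Unset Printing Implicit Defensive.
Import Order.TTheory GRing.Theory Num.Theory Num.Def.
Import numFieldNormedType.Exports.
Local Open Scope classical_set_scope.
Local Open Scope ring_scope.
Local Open Scope complex_scope.

(* A complex Hilbert space: a complete normed space over R[i] whose norm comes
   from an inner product, which is linear in its first argument and
   conjugate-linear in its second one. *)
Record hilbertSpace (R : realType) := HilbertSpace {
  hilbert_carrier :> completeNormedModType R[i] ;
  hdot : {dot hilbert_carrier for conjC} ;
  hdotxx : forall x, hdot x x = `|x| ^+ 2 }.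

Local Notation "''[' u , v ]" := (hdot _ u v) : ring_scope.

Section InnerProduct.
Context (R : realType) (H : hilbertSpace R).
Implicit Types (u v w : H) (S : set H).

Lemma hdotC u v : '[u, v] = '[v, u]^*%R.
Proof. by rewrite hermC expr0 mul1r. Qed.

Lemma hdot_eq0C u v : '[u, v] = 0 -> '[v, u] = 0.
Proof. by move=> uv0; rewrite hdotC uv0 rmorph0. Qed.

Lemma hdotBZ u v (c : R[i]) :
  '[u - c *: v, u - c *: v] =
  '[u, u] - c^*%R * '[u, v] - c * '[u, v]^*%R + c * c^*%R * '[v, v].
Proof.
rewrite linearBl/= !linearBr/= !linearZl_LR !linearZr_LR/= -(hdotC v u).
ring.
Qed.

Lemma hdot_min u v : '[v, v] != 0 ->
  let c := '[u, v] / '[v, v] in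
  '[u - c *: v, u - c *: v] = '[u, u] - `|'[u, v]| ^+ 2 / '[v, v].
Proof.
move=> v0 c; rewrite hdotBZ /c rmorphM fmorphV normCK /= -(hdotC v v).
by field.
Qed.

Lemma hdot_norm_le u v : `|'[u, v]| <= `|u| * `|v|.
Proof.
have [->|v0] := eqVneq v 0; first by rewrite linear0r !normr0 mulr0.
have q0 : '[v, v] != 0 by rewrite hdotxx sqrf_eq0 normr_eq0.
have := hdot_min u q0 => /= h.
have : 0 <= '[u, u] - `|'[u, v]| ^+ 2 / '[v, v].
  by rewrite -h hdotxx exprn_ge0.
rewrite subr_ge0 !hdotxx ler_pdivrMr ?exprn_gt0 ?normr_gt0//.
by rewrite -exprMn ler_sqr ?nnegrE ?mulr_ge0.
Qed.

Lemma parallelogram u v :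
  `|u + v| ^+ 2 + `|u - v| ^+ 2 = 2 * `|u| ^+ 2 + 2 * `|v| ^+ 2.
Proof.
rewrite -!hdotxx !linearDl/= !linearDr/= !linearNl !linearNr.
ring.
Qed.

(* Norms of vectors are elements of R[i]; rnorm is the norm as a real number. *)
Definition rnorm u : R := complex.Re `|u|.

Lemma rnormE u : `|u| = (rnorm u)%:C.
Proof. by rewrite /rnorm RRe_real// ger0_real. Qed.

Lemma rnorm_ge0 u : 0 <= rnorm u.
Proof. by rewrite -ler0c -rnormE. Qed.

Lemma rnormD u v : rnorm (u + v) <= rnorm u + rnorm v.
Proof. by rewrite -lecR rmorphD/= -!rnormE ler_normD. Qed.

Lemma rparallelogram u v :
  rnorm (u + v) ^+ 2 + rnorm (u - v) ^+ 2 = 2 * rnorm u ^+ 2 + 2 * rnorm v ^+ 2.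
Proof.
apply: (@complexI R); have := parallelogram u v.
by rewrite !rnormE !rmorphD !rmorphM /= !rmorph_nat.
Qed.

Lemma rnormZ (a : R) u : rnorm (a%:C *: u) = `|a| * rnorm u.
Proof.
apply: (@complexI R); rewrite rmorphM/= -!rnormE normrZ; congr (_ * _).
by rewrite normc_def/= expr0n/= addr0 sqrtr_sqr.
Qed.

Lemma nbhs_rnorm (u : H) (A : set H) (e : R) : 0 < e ->
  (forall v, rnorm (u - v) < e -> A v) -> nbhs u A.
Proof.
move=> e0 uA; apply/nbhs_ballP; exists e%:C; first by rewrite /= ltcR.
by move=> v; rewrite -ball_normE/= rnormE ltcR; exact: uA.
Qed.

Lemma closed_ker (f : H -> R[i]) (c : R) :
  {morph f : u v / u - v} -> (forall u, `|f u| <= c%:C * `|u|) ->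
  closed [set u | f u = 0].
Proof.
move=> fB fc u clu /=; apply/eqP/negPn/negP => fu0.
pose c' := Num.max c 1.
have c'0 : 0 < c' by rewrite lt_max ltr01 orbT.
pose e := complex.Re `|f u| / c'.
have fuE : `|f u| = (e * c')%:C.
  by rewrite /e divfK ?gt_eqF// RRe_real// ger0_real.
have e0 : 0 < e.
  by rewrite -(pmulr_lgt0 _ c'0) -ltcR -fuE normr_gt0.
have [v [/= fv0 uv]] := clu _ (nbhs_rnorm e0 (fun v => id)).
have := fc (u - v); rewrite fB fv0 subr0 fuE rnormE -rmorphM lecR/=.
apply/negP; rewrite -ltNge.
apply: (@le_lt_trans _ _ (c' * rnorm (u - v))).
  by rewrite ler_wpM2r ?rnorm_ge0// le_max lexx.
by rewrite mulrC ltr_pM2r.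
Qed.

End InnerProduct.

Record closedSubspace (R : realType) (H : hilbertSpace R) := ClosedSubspace {
  cs_set :> set H ;
  cs_closed : closed cs_set ;
  cs_submod : submod_closed [in cs_set] }.

Section SubHilbert.
Context (R : realType) (H : hilbertSpace R) (S : closedSubspace H).

Definition subspace_type : Type := set_type S.

HB.instance Definition _ := SubChoice.on subspace_type.
HB.instance Definition _ := GRing.SubChoice_isSubLmodule.Build
  R[i] H [in (S : set H)] subspace_type (GRing.submod_closed_semi (cs_submod S)).

Implicit Types u v : subspace_type.

Let norm u : R[i] := `|val u|.

Let normD u v : norm (u + v) <= norm u + norm v.
Proof. exact: ler_normD. Qed.

Let normZ (a : R[i]) u : norm (a *: u) = `|a| * norm u.
Proof. exact: normrZ. Qed.

Let norm_eq0 u : norm u = 0 -> u = 0.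
Proof. by move=> /normr0_eq0 u0; apply: val_inj; rewrite u0. Qed.

HB.instance Definition _ :=
  Lmodule_isNormed.Build R[i] subspace_type normD normZ norm_eq0.

Let complete (F : set_system subspace_type) :
  ProperFilter F -> cauchy F -> cvg F.
Proof.
move=> FF /cauchyP Fc.
pose G := (val : subspace_type -> H) @ F.
have /cauchy_cvg Gl : cauchy G.
  apply: cauchy_exP => e e0; have [u Fu] := Fc e e0.
  exists (val u); apply: (filterS (F := F) _ Fu) => v.
  by rewrite -!ball_normE.
have Sl : [in (S : set H)] (lim G).
  apply/mem_set.
  apply: (@closed_cvg _ _ F _ (val : subspace_type -> H) (cs_set S)
    (cs_closed (c := S)) _ _ Gl).
  by apply: nearW => u; exact/set_mem/valP.
apply/cvg_ex; exists (Sub (lim G) Sl : subspace_type).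
apply/cvg_ballP => e e0.
move/cvg_ballP : Gl => /(_ e e0); rewrite /G near_map.
by apply: filterS => u; rewrite -!ball_normE.
Qed.

HB.instance Definition _ := Uniform_isComplete.Build subspace_type complete.

Definition sub_dot u v : R[i] := hdot H (val u) (val v).

Let sub_dotBl v : GRing.zmod_morphism (sub_dot^~ v).
Proof.
by move=> u w; rewrite /sub_dot (raddfB (val : subspace_type -> H)) linearBl.
Qed.

Let sub_dotBr u : GRing.zmod_morphism (sub_dot u).
Proof.
by move=> v w; rewrite /sub_dot (raddfB (val : subspace_type -> H)) linearBr.
Qed.

Let sub_dotZl v : scalable_for *%R (sub_dot^~ v).
Proof. by move=> a u; rewrite /sub_dot GRing.valZ linearZl_LR. Qed.

Let sub_dotZr u : scalable_for (conjC \; *%R) (sub_dot u).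
Proof. by move=> a v; rewrite /sub_dot GRing.valZ linearZr_LR. Qed.

HB.instance Definition _ := isBilinear.Build R[i] subspace_type subspace_type
  R[i] *%R (conjC \; *%R) sub_dot sub_dotBl sub_dotBr sub_dotZl sub_dotZr.

Let sub_dot_herm u v : sub_dot u v = (-1) ^+ false * (sub_dot v u)^*%R.
Proof. exact: hermC. Qed.

HB.instance Definition _ := isHermitianSesquilinear.Build
  R[i] subspace_type false conjC sub_dot sub_dot_herm.

Let sub_dot_gt0 u : u != 0 -> 0 < sub_dot u u.
Proof.
by move=> u0; rewrite neq0_dnorm_gt0// -(raddf0 val) (inj_eq val_inj).
Qed.

HB.instance Definition _ :=
  isDotProduct.Build R[i] subspace_type sub_dot sub_dot_gt0.

Let sub_dotxx u : sub_dot u u = `|u| ^+ 2.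
Proof. exact: hdotxx. Qed.

Definition subHilbert : hilbertSpace R := HilbertSpace sub_dotxx.

End SubHilbert.

Section Projection.
Context (R : realType) (H : hilbertSpace R) (S : closedSubspace H).
Implicit Types x u v : H.

Lemma cs0 : cs_set S 0.
Proof. by have [/set_mem] := cs_submod S. Qed.

Lemma csP (a : R[i]) u v : cs_set S u -> cs_set S v -> cs_set S (a *: u + v).
Proof.
by move=> /mem_set Su /mem_set Sv; apply/set_mem; apply: (cs_submod S).2.
Qed.

Lemma csD u v : cs_set S u -> cs_set S v -> cs_set S (u + v).
Proof. by move=> Su Sv; rewrite -[u]scale1r; exact: csP. Qed.

Lemma csZ (a : R[i]) u : cs_set S u -> cs_set S (a *: u).
Proof. by move=> Su; rewrite -[_ *: _]addr0; apply: csP => //; exact: cs0. Qed.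

Lemma csB u v : cs_set S u -> cs_set S v -> cs_set S (u - v).
Proof. by move=> Su Sv; rewrite -scaleN1r addrC; exact: csP. Qed.

Lemma minimizer_orth x p : cs_set S p ->
  (forall s, cs_set S s -> rnorm (x - p) <= rnorm (x - s)) ->
  forall s, cs_set S s -> hdot H (x - p) s = 0.
Proof.
move=> Sp pmin s Ss.
have [->|s0] := eqVneq s 0; first by rewrite linear0r.
have q0 : 0 < hdot H s s by exact: neq0_dnorm_gt0.
have := hdot_min (x - p) (lt0r_neq0 q0).
set c := _ / _ => /= cE.
have : `|x - p| <= `|x - p - c *: s|.
  rewrite !rnormE lecR -addrA -opprD; apply: pmin.
  by apply: csD => //; exact: csZ.
rewrite -ler_sqr ?nnegrE// -!hdotxx cE lerDl oppr_ge0 => h.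
apply/eqP; rewrite -normr_eq0 -sqrf_eq0.
have := h; rewrite pmulr_lle0 ?invr_gt0// => h'.
by rewrite eq_le h'/= exprn_ge0.
Qed.

Lemma minimizer_exists x :
  exists2 p, cs_set S p &
    forall s, cs_set S s -> rnorm (x - p) <= rnorm (x - s).
Proof.
pose E := [set rnorm (x - s) | s in (S : set H)].
pose d := inf E.
have Elb : lbound E 0 by move=> _ [s _ <-]; exact: rnorm_ge0.
have hE : has_inf E.
  by split; [exists (rnorm (x - 0)), 0 => //; exact: cs0|exists 0].
have dE s : cs_set S s -> d <= rnorm (x - s).
  by move=> Ss; apply: ge_inf; [exists 0|exists s].
have d0 : 0 <= d by apply: lb_le_inf => //; exact: hE.1.
pose B (e : R) := [set s | cs_set S s /\ rnorm (x - s) < d + e].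
have B0 e : 0 < e -> B e !=set0.
  by move=> e0; have [_ [s Ss <-] se] := inf_adherent e0 hE; exists s.
pose F := filter_from [set e : R | 0 < e] B.
have FF : ProperFilter F.
  apply: filter_from_proper => //.
  apply: filter_from_filter; first by exists 1 => /=.
  move=> e1 e2 /= e10 e20.
  exists (Num.min e1 e2); first by rewrite /= lt_min e10.
  move=> s [Ss]; rewrite -ltrBlDl lt_min => /andP[h1 h2].
  by split; split; rewrite // -ltrBlDl.
have BB e s t : 0 < e -> B e s -> B e t ->
    rnorm (s - t) ^+ 2 < 4 * (d + e) ^+ 2 - 4 * d ^+ 2.
  move=> e0 [Ss se] [St te].
  have := rparallelogram (x - t) (x - s).
  rewrite (_ : x - t - (x - s) = s - t); last first.
    by rewrite opprB addrC addrA subrK.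
  have -> : x - t + (x - s) = 2%:C *: (x - (2^-1)%:C *: (s + t)).
    rewrite scalerBr scalerA -rmorphM/= mulfV ?pnatr_eq0// scale1r.
    rewrite rmorph_nat scaler_nat mulr2n opprD addrACA; congr (_ + _).
    by rewrite addrC.
  rewrite rnormZ ger0_norm//.
  have := dE _ (csZ (2^-1)%:C (csD Ss St)).
  set m := rnorm (x - _ *: _).
  have := rnorm_ge0 (x - t); have := rnorm_ge0 (x - s).
  move: se te; move: (rnorm (x - s)) (rnorm (x - t)) (rnorm (s - t)) => a b c.
  move=> ad bd a0 b0 dm.
  have : d ^+ 2 <= m ^+ 2 by rewrite ler_sqr ?nnegrE// (le_trans d0).
  have : a ^+ 2 < (d + e) ^+ 2 by rewrite ltr_sqr ?nnegrE// addr_ge0// ltW.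
  have : b ^+ 2 < (d + e) ^+ 2 by rewrite ltr_sqr ?nnegrE// addr_ge0// ltW.
  by rewrite exprMn; lra.
have Fc : cauchy F.
  apply: cauchy_exP => eps eps0.
  have epsE : eps = (complex.Re eps)%:C by rewrite RRe_real// gtr0_real.
  move: eps0; rewrite epsE ltcR; move: (complex.Re eps) => e {eps epsE} e0.
  pose k := Num.min 1 (e ^+ 2 / (4 * (2 * d + 1))).
  have D0 : 0 < 4 * (2 * d + 1) by lra.
  have k0 : 0 < k by rewrite lt_min ltr01 divr_gt0// exprn_gt0.
  have k1 : k <= 1 by rewrite ge_min lexx.
  have ke : k * (4 * (2 * d + 1)) <= e ^+ 2.
    by rewrite -ler_pdivlMr// ge_min lexx orbT.
  have [s Bs] := B0 k k0; exists s, k => //= t Bt.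
  rewrite -ball_normE/= rnormE ltcR -ltr_sqr ?nnegrE ?rnorm_ge0 ?(ltW e0)//.
  apply: lt_le_trans (BB _ _ _ k0 Bs Bt) _.
  apply: le_trans ke; nra.
have /cvg_ex[p Fp] : cvg F by exact: cauchy_cvg.
exists p.
  apply: (@closed_cvg _ _ F _ id (cs_set S) (cs_closed (c := S)) _ _ Fp).
  by exists 1 => //= s [].
move=> s Ss; apply: le_trans (dE s Ss); apply/ler_addgt0Pr => e e0.
have e20 : 0 < e / 2 by rewrite divr_gt0.
have : F (ball p (e / 2)%:C).
  by apply: Fp; apply: nbhsx_ballx; rewrite ltcR.
move=> Fb; have FB : F (B (e / 2)) by exists (e / 2).
have [t [pt [_ tx]]] := filter_ex (filterI Fb FB).
move: pt; rewrite -ball_normE/= rnormE ltcR => pt.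
have -> : x - p = (x - t) - (p - t) by rewrite opprB addrA subrK.
apply: (le_trans (rnormD _ _)).
have -> : rnorm (- (p - t)) = rnorm (p - t) by rewrite /rnorm normrN.
lra.
Qed.

Lemma projection_theorem x :
  exists p : subspace_type S, forall s, cs_set S s -> hdot H (x - val p) s = 0.
Proof.
have [p /[dup] Sp /mem_set Sp' pmin] := minimizer_exists x.
exists (Sub p Sp' : subspace_type S) => s Ss; rewrite SubK.
exact: minimizer_orth.
Qed.

Definition orthproj x : subspace_type S :=
  xget 0 [set p : subspace_type S |
    forall s, cs_set S s -> hdot H (x - val p) s = 0].

Lemma orthprojP x s : cs_set S s -> hdot H (x - val (orthproj x)) s = 0.
Proof. by move=> Ss; exact: (xgetPex 0 (projection_theorem x)). Qed.

Lemma orthproj_uniq x (p : subspace_type S) :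
  (forall s, cs_set S s -> hdot H (x - val p) s = 0) -> orthproj x = p.
Proof.
move=> xp; apply/eqP; rewrite -subr_eq0 -(inj_eq val_inj) raddf0 -normr_eq0.
rewrite -sqrf_eq0 -hdotxx.
have Sd : cs_set S (val (orthproj x - p)) by exact/set_mem/valP.
have dE : val (orthproj x - p) = (x - val p) - (x - val (orthproj x)).
  by rewrite raddfB opprB [RHS]addrC addrA subrK.
move: (val (orthproj x - p)) Sd dE => s Ss dE.
by rewrite {1}dE linearBl/= xp// orthprojP// subrr.
Qed.

Lemma orthproj_is_linear : linear orthproj.
Proof.
move=> a u v; apply: orthproj_uniq => s Ss.
have -> : val (a *: orthproj u + orthproj v) =
    a *: val (orthproj u) + val (orthproj v) by [].
rewrite opprD addrACA -scalerBr.
move: (orthprojP u Ss) (orthprojP v Ss).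
move: (u - _) (v - _) => u' v' u'0 v'0.
by rewrite linearDl linearZl_LR/= u'0 v'0 mulr0 addr0.
Qed.

Lemma norm_orthproj x : `|val (orthproj x)| <= `|x|.
Proof.
have Sp : cs_set S (val (orthproj x)) by exact/set_mem/valP.
have := orthprojP x Sp; move: (val (orthproj x)) => p xp0.
rewrite -ler_sqr ?nnegrE// -(subrK p x) -hdotxx -(hdotxx (_ + _)).
by rewrite hnormDd//= lerDr hdotxx exprn_ge0.
Qed.

End Projection.

Section Orthocomplement.
Context (R : realType) (H : hilbertSpace R).

Definition orthocompl (S : set H) : set H :=
  [set v | forall s, S s -> hdot H v s = 0].

Lemma orthocompl_closed (S : set H) : closed (orthocompl S).
Proof.
rewrite (_ : orthocompl S = \bigcap_(s in S) [set v | hdot H v s = 0])//.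
apply: closed_bigI => s Ss.
apply: (@closed_ker _ H (fun v => hdot H v s) (rnorm s)).
  by move=> u v; rewrite linearBl.
by move=> u; rewrite mulrC -rnormE hdot_norm_le.
Qed.

Lemma orthocompl_submod (S : set H) : submod_closed [in orthocompl S].
Proof.
split; first by apply/mem_set => s _; rewrite linear0l.
move=> a u v /set_mem Su /set_mem Sv; apply/mem_set => s Ss.
by rewrite linearDl linearZl_LR/= Su// Sv// mulr0 addr0.
Qed.

Definition orthocompl_space (S : set H) : closedSubspace H :=
  ClosedSubspace (@orthocompl_closed S) (@orthocompl_submod S).

Lemma orthocomplK (S : closedSubspace H) v :
  orthocompl (orthocompl S) v -> cs_set S v.
Proof.
move=> vSoo.
have So : orthocompl S (v - val (orthproj S v)).
  by move=> s; exact: orthprojP.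
have Sp : cs_set S (val (orthproj S v)) by exact/set_mem/valP.
suff /eqP : v - val (orthproj S v) = 0 by rewrite subr_eq0 => /eqP ->.
move: (val (orthproj S v)) So Sp => p So Sp.
apply/eqP; rewrite -normr_eq0 -sqrf_eq0 -hdotxx linearBl /= vSoo//.
by rewrite (hdot_eq0C (So _ Sp)) subrr.
Qed.

End Orthocomplement.

Section Operators.
Context (R : realType) (H : hilbertSpace R).
Implicit Types (T : H -> H) (x y : H).

Definition bounded_operator T : Prop :=
  exists c : R, forall x, `|T x| <= c%:C * `|x|.

(* The y-th value is the z such that <T x, y> = <x, z> for every x; it exists
   when T is linear and bounded (adjointP below), and it is always unique. *)
Definition adjoint T : H -> H :=
  fun y => xget 0 [set z | forall x, hdot H (T x) y = hdot H x z].

Definition self_commutator T : H -> H :=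
  fun x => adjoint T (T x) - T (adjoint T x).

Definition compact_operator T : Prop :=
  precompact (T @` [set x | `|x| <= 1]).

Lemma riesz (f : H -> R[i]) (c : R) : scalar f ->
  (forall x, `|f x| <= c%:C * `|x|) -> exists z, forall x, f x = hdot H x z.
Proof.
move=> flin fc.
have fB : {morph f : u v / u - v}.
  by move=> u v; rewrite -scaleN1r addrC flin mulN1r addrC.
have f0 : f 0 = 0 by rewrite -(subrr 0) fB subrr.
have fZ a u : f (a *: u) = a * f u by rewrite -[_ *: _]addr0 flin f0 addr0.
have Ksub : submod_closed [in [set u | f u = 0]].
  split; first exact/mem_set.
  move=> a u v /set_mem/= fu /set_mem/= fv; apply/mem_set => /=.
  by rewrite flin fu fv mulr0 addr0.
pose K := ClosedSubspace (closed_ker fB fc) Ksub.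
have [fall0|/existsNP[v fv0]] := pselect (forall u, f u = 0).
  by exists 0 => x; rewrite fall0 linear0r.
have Kp : f (val (orthproj K v)) = 0 := set_mem (valP (orthproj K v)).
have Ko := @orthprojP _ _ K v.
move: (val (orthproj K v)) Kp Ko => p fp Ko.
set w := v - p in Ko.
have fw : f w = f v by rewrite fB fp subr0.
have w0 : w != 0 by apply: contra_notN fv0 => /eqP w0; rewrite -fw w0.
have q0 : hdot H w w != 0 by rewrite gt_eqF// neq0_dnorm_gt0.
exists ((f w / hdot H w w)^*%R *: w) => x.
rewrite linearZr_LR/= conjCK.
have : hdot H w (x - (f x / f w) *: w) = 0.
  by apply: Ko => /=; rewrite fB fZ divfK ?subrr// fw; exact/eqP.
move/hdot_eq0C; rewrite linearBl linearZl_LR /= => /eqP.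
rewrite subr_eq0 => /eqP ->.
have fw0 : f w != 0 by rewrite fw; exact/eqP.
by field; rewrite fw0.
Qed.

Lemma adjointP T : linear T -> bounded_operator T ->
  forall x y, hdot H (T x) y = hdot H x (adjoint T y).
Proof.
move=> Tlin [c Tc] x y.
suff: exists z, forall x, hdot H (T x) y = hdot H x z.
  by move/(xgetPex (0 : H)); exact.
apply: (@riesz _ (c * rnorm y)).
  by move=> a u v; rewrite Tlin linearDl linearZl_LR.
move=> u; apply: le_trans (hdot_norm_le _ _) _.
by rewrite rmorphM/= -rnormE mulrAC ler_wpM2r.
Qed.

End Operators.

(* An associative algebra over R[i]; neither a unit nor commutativity is
   required. *)
Record complexAlgebra (R : realType) := ComplexAlgebra {
  alg_carrier :> lmodType R[i] ;
  alg_mul : {bilinear alg_carrier -> alg_carrier -> alg_carrier} ;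
  alg_mulA : associative alg_mul }.

(* No relation between the bounds on the various hmod_act a is assumed. *)
Record hilbertModule (R : realType) (A : complexAlgebra R) := HilbertModule {
  hmod_space :> hilbertSpace R ;
  hmod_act : {bilinear A -> hmod_space -> hmod_space} ;
  hmod_actM : forall a b f,
    hmod_act (alg_mul A a b) f = hmod_act a (hmod_act b f) ;
  hmod_act_bounded : forall a, bounded_operator (hmod_act a) }.

Definition essentially_reductive (R : realType) (A : complexAlgebra R)
    (M : hilbertModule A) : Prop :=
  forall a : A, compact_operator (self_commutator (hmod_act M a)).

Record hilbertSubmodule (R : realType) (A : complexAlgebra R)
    (M : hilbertModule A) := HilbertSubmodule {
  submod_space :> closedSubspace M ;
  submod_act : forall a f,
    cs_set submod_space f -> cs_set submod_space (hmod_act M a f) }.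

Section Submodule.
Context (R : realType) (A : complexAlgebra R) (M : hilbertModule A).
Context (N : hilbertSubmodule M).

Definition sub_act (a : A) (f : subHilbert N) : subHilbert N :=
  Sub (hmod_act M a (val f)) (mem_set (submod_act a (set_mem (valP f)))).

Let sub_actBl f : GRing.zmod_morphism (sub_act^~ f).
Proof. by move=> a b; apply: val_inj; exact: linearBl. Qed.

Let sub_actBr a : GRing.zmod_morphism (sub_act a).
Proof. by move=> f g; apply: val_inj; exact: linearBr. Qed.

Let sub_actZl f : scalable_for *:%R (sub_act^~ f).
Proof. by move=> c a; apply: val_inj; exact: linearZl_LR. Qed.

Let sub_actZr a : scalable_for *:%R (sub_act a).
Proof. by move=> c f; apply: val_inj; exact: linearZr_LR. Qed.

HB.instance Definition _ := isBilinear.Build R[i] A (subHilbert N)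
  (subHilbert N) *:%R *:%R sub_act sub_actBl sub_actBr sub_actZl sub_actZr.

Let sub_actM a b f : sub_act (alg_mul A a b) f = sub_act a (sub_act b f).
Proof. by apply: val_inj; exact: hmod_actM. Qed.

Let sub_act_bounded a : bounded_operator (sub_act a).
Proof. by have [c Mc] := hmod_act_bounded M a; exists c => f; exact: Mc. Qed.

Definition submodule : hilbertModule A :=
  HilbertModule sub_actM sub_act_bounded.

End Submodule.

Section Quotient.
Context (R : realType) (A : complexAlgebra R) (M : hilbertModule A).
Context (N : hilbertSubmodule M).

(* The quotient M / N is realized as the orthogonal complement of N, on which
   a acts by the compression of hmod_act M a. The map quot_proj is the quotient
   map: it is linear (quot_proj_linear) and surjective (quot_proj_surj) with
   kernel N (quot_proj_eq0), it intertwines the actions (quot_projM), and the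
   norm of quot_proj f is the minimum of `|f + n| for n in N (quot_norm). *)
Definition quotHilbert : hilbertSpace R :=
  subHilbert (orthocompl_space (submod_space N)).

Definition quot_proj (f : M) : quotHilbert :=
  orthproj (orthocompl_space N) f.

Definition quot_act (a : A) (f : quotHilbert) : quotHilbert :=
  quot_proj (hmod_act M a (val f)).

Lemma quot_proj_linear : linear quot_proj.
Proof. exact: orthproj_is_linear. Qed.

Let quot_projB : {morph quot_proj : u v / u - v}.
Proof.
by move=> u v; rewrite -scaleN1r addrC quot_proj_linear scaleN1r addrC.
Qed.

Let quot_projZ a f : quot_proj (a *: f) = a *: quot_proj f.
Proof.
by rewrite -[_ *: _]addr0 quot_proj_linear -(subrr 0) quot_projB !subrr addr0.
Qed.

Lemma quot_proj_surj (f : quotHilbert) : quot_proj (val f) = f.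
Proof. by apply: orthproj_uniq => s _; rewrite subrr linear0l. Qed.

Lemma quot_proj_sub f : cs_set N (f - val (quot_proj f)).
Proof.
by apply: orthocomplK => s; exact: (@orthprojP _ _ (orthocompl_space N) f).
Qed.

Lemma quot_proj_eq0 f : quot_proj f = 0 <-> cs_set N f.
Proof.
split=> [f0|Nf]; first by have := quot_proj_sub f; rewrite f0 subr0.
apply: orthproj_uniq => s Ns; rewrite subr0; apply: hdot_eq0C; exact: Ns.
Qed.

Lemma quot_projM a f :
  quot_proj (hmod_act M a f) = quot_act a (quot_proj f).
Proof.
apply/eqP; rewrite /quot_act -subr_eq0 -quot_projB -linearBr.
apply/eqP/quot_proj_eq0.
exact/submod_act/quot_proj_sub.
Qed.

Lemma quot_norm f :
  (forall n, cs_set N n -> `|quot_proj f| <= `|f + n|) /\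
  (exists2 n, cs_set N n & `|quot_proj f| = `|f + n|).
Proof.
split=> [n Nn|].
  have -> : quot_proj f = quot_proj (f + n).
    by rewrite addrC -[n]scale1r quot_proj_linear (quot_proj_eq0 n).2//
      scaler0 add0r.
  exact: norm_orthproj.
exists (val (quot_proj f) - f); last by rewrite addrC subrK.
by rewrite -opprB -scaleN1r; apply: csZ; exact: quot_proj_sub.
Qed.

Let quot_actB_l f : GRing.zmod_morphism (quot_act^~ f).
Proof. by move=> a b; rewrite /quot_act linearBl quot_projB. Qed.

Let quot_actB_r a : GRing.zmod_morphism (quot_act a).
Proof.
by move=> f g; rewrite /quot_act [val _]raddfB linearBr quot_projB.
Qed.

Let quot_actZ_l f : scalable_for *:%R (quot_act^~ f).
Proof. by move=> c a; rewrite /quot_act linearZl_LR quot_projZ. Qed.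

Let quot_actZ_r a : scalable_for *:%R (quot_act a).
Proof. by move=> c f; rewrite /quot_act GRing.valZ linearZr_LR quot_projZ. Qed.

HB.instance Definition _ := isBilinear.Build R[i] A quotHilbert
  quotHilbert *:%R *:%R quot_act quot_actB_l quot_actB_r quot_actZ_l quot_actZ_r.

Let quot_actM a b f : quot_act (alg_mul A a b) f = quot_act a (quot_act b f).
Proof. by rewrite {1 3}/quot_act hmod_actM quot_projM. Qed.

Let quot_act_bounded a : bounded_operator (quot_act a).
Proof.
have [c Mc] := hmod_act_bounded M a; exists c => f.
exact: le_trans (norm_orthproj _ _) (Mc _).
Qed.

Definition quotient : hilbertModule A :=
  HilbertModule quot_actM quot_act_bounded.

End Quotient.

(* Main.v *)
(* Relative to M = N + Q, with Q the orthogonal complement of N, the action of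
   an element is a block matrix T = [[A, B], [0, C]], and the diagonal blocks
   of D = T* T - T T* are [A*, A] - B B* and [C*, C] + B* B. If D is compact,
   then [A*, A] is compact iff B B* is, and [C*, C] is compact iff B* B is.
   Finally |B* x|^2 <= |B B* x| |x| shows that if B B* is compact then so is
   B*, hence so is B* B; the converse is symmetric. *)
Require Import Defs.
From mathcomp Require Import reals.
From mathcomp Require Import all_boot all_order all_algebra.
From mathcomp Require Import sesquilinear complex boolp classical_sets.
From mathcomp Require Import functions filter topology normedtype lra.
Set Implicit Arguments.
Unset Strict Implicit.
Unset Printing Implicit Defensive.
Import Order.TTheory GRing.Theory Num.Theory Num.Def.
Import numFieldNormedType.Exports.
Local Open Scope classical_set_scope.
Local Open Scope ring_scope.
Local Open Scope complex_scope.

(** * Images of ultrafilters, and neighbourhoods in terms of the real norm *)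

Lemma ultra_map (X Y : Type) (f : X -> Y) (F : set_system X) :
  UltraFilter F -> UltraFilter (f @ F).
Proof.
move=> FU; split=> [|G GF FG]; first exact: fmap_proper_filter.
rewrite eqEsubset; split=> // A GA.
(* If the preimage of [A] were not in [F], the finer filter [G] would contain both [A] and its
   complement. *)
have [//|FnA] := in_ultra_setVsetC (f @^-1` A) FU.
have GnA : G (~` A) by exact: FG.
by have [y []] := filter_ex (filterI GA GnA).
Qed.

Section HilbertNorm.
Context (R : realType) (H : hilbertSpace R).
Implicit Types (u v : H) (A : set H).

Lemma nbhs_rnormP u A :
  nbhs u A <-> exists2 e : R, 0 < e & forall v, rnorm (u - v) < e -> A v.
Proof.
split=> [/nbhs_ballP[e /= e0 eA]|[e e0 eA]]; last exact: nbhs_rnorm eA.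
have eE : e = (complex.Re e)%:C by rewrite RRe_real// gtr0_real.
exists (complex.Re e); first by rewrite -ltcR -eE.
move=> v uv; apply: eA; rewrite -ball_normE /ball_ /= rnormE eE ltcR; exact: uv.
Qed.

Lemma rnormN u : rnorm (- u) = rnorm u.
Proof. by rewrite /rnorm normrN. Qed.

Lemma rnorm_sub_trans v u w : rnorm (u - w) <= rnorm (u - v) + rnorm (v - w).
Proof. by rewrite -[u - w](subrKA v) rnormD. Qed.

Lemma rnormBC u v : rnorm (u - v) = rnorm (v - u).
Proof. by rewrite -opprB rnormN. Qed.

End HilbertNorm.

(** * Compactness tested on ultrafilters *)

Section UltraCauchy.
Context (R : realType).
Implicit Types (H K L : hilbertSpace R).

Definition unit_ball H : set H := [set x | rnorm x <= 1].

(* For linear maps this is compactness, in a form that passes to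
   subspaces, sums and composites without choosing subsequences. *)
Definition ultra_cauchy H K (T : H -> K) : Prop :=
  forall F : set_system H, UltraFilter F -> F (@unit_ball H) ->
  forall e : R, 0 < e ->
  exists2 A, F A & forall x y, A x -> A y -> rnorm (T x - T y) < e.

Lemma unit_ballE H : [set x : H | `|x| <= 1] = @unit_ball H.
Proof. by apply/seteqP; split=> x /=; rewrite rnormE -[1]/(1%:C) lecR. Qed.

(** The image of [F] is an ultrafilter on a compact set, so it converges to some [p]; the preimage
    of a ball of radius [e / 2] at [p] is the required set. *)
Lemma compact_ultra_cauchy H (T : H -> H) :
  compact_operator T -> ultra_cauchy T.
Proof.
rewrite /compact_operator unit_ballE precompactE compact_ultra => Tc F FU FB e e0.
have [|p [_ Fp]] := Tc (T @ F) (ultra_map T FU).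
  by apply: (filterS (F := F) _ FB) => x Bx; apply: subset_closure; exists x.
have e20 : 0 < e / 2 by rewrite divr_gt0.
exists (T @^-1` [set y | rnorm (p - y) < e / 2]).
  by apply: Fp; apply/nbhs_rnormP; exists (e / 2).
move=> x y /= px py; apply: le_lt_trans (rnorm_sub_trans p _ _) _.
rewrite rnormBC; lra.
Qed.

(** Completeness of [H] supplies a limit for the image of an ultrafilter [F] on the unit ball, and
    [F] is chosen so that [G] must have the same limit. *)
Lemma ultra_cauchy_compact H (T : H -> H) :
  ultra_cauchy T -> compact_operator T.
Proof.
move=> Tuc.
rewrite /compact_operator unit_ballE precompactE compact_ultra => G GU Gcl.
(* G lives on the closure of the image: pull its thickenings back along T. *)
pose D := [set eg : R * set H | 0 < eg.1 /\ G eg.2].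
pose B (eg : R * set H) := @unit_ball H `&`
  [set x | exists2 z, eg.2 z & rnorm (T x - z) < eg.1].
have PF : ProperFilter (filter_from D B).
  apply: filter_from_proper.
    apply: filter_from_filter.
      by exists (1, setT); split=> //=; exact: filterT.
    move=> [e1 g1] [e2 g2] [/= e10 Gg1] [/= e20 Gg2].
    exists (Num.min e1 e2, g1 `&` g2).
      by split; rewrite /= ?lt_min ?e10//; exact: filterI.
    move=> x [Bx [z [g1z g2z]]] /=; rewrite lt_min => /andP[h1 h2].
    by split; split=> //; exists z.
  (* These sets are nonempty: a point of [g] in the closure of the image is approximated by some
     [T x]. *)
  move=> [e g] [/= e0 Gg].
  have [z [clz gz]] := filter_ex (filterI Gcl Gg).
  have /clz[_ [[x Bx <-] /= zx]] : nbhs z [set y | rnorm (z - y) < e].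
    by apply/nbhs_rnormP; exists e.
  by exists x; split=> //; exists z => //; rewrite rnormBC.
have [F [FU DF]] := ultraFilterLemma PF.
have FB : F (@unit_ball H).
  apply: DF; exists (1, setT); first by split=> //=; exact: filterT.
  by move=> x [].
have TFc : cauchy (T @ F).
  apply: cauchy_exP => e e0.
  have eE : e = (complex.Re e)%:C by rewrite RRe_real// gtr0_real.
  have e0' : 0 < complex.Re e by rewrite -ltcR -eE.
  have [A FA AT] := Tuc F FU FB _ e0'.
  have [x Ax] := filter_ex FA; exists (T x).
  apply: (filterS (F := F) _ FA) => y Ay.
  rewrite /= -ball_normE /ball_ /= rnormE eE ltcR; exact: AT.
have /cvg_ex[p Fp] : cvg (T @ F) by exact: cauchy_cvg.
exists p; split.
  move=> U /Fp FTU; have [x [Bx Ux]] := filter_ex (filterI FB (FTU : F (T @^-1` U))).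
  by exists (T x); split=> //; exists x.
move=> V /nbhs_rnormP[e e0 eV].
(* Otherwise some [T x] lies within [e / 2] both of [p] and of a point outside [V], although [V]
   contains the [e]-ball at [p]. *)
have [//|GnV] := in_ultra_setVsetC V GU.
have e20 : 0 < e / 2 by rewrite divr_gt0.
have F1 : F (B (e / 2, ~` V)) by apply: DF; exists (e / 2, ~` V).
have F2 : F (T @^-1` [set y | rnorm (p - y) < e / 2]).
  by apply: Fp; apply/nbhs_rnormP; exists (e / 2).
have [x [[_ [z nVz /= xz]] /= px]] := filter_ex (filterI F1 F2).
case: nVz; apply: eV; apply: le_lt_trans (rnorm_sub_trans (T x) _ _) _; lra.
Qed.

Lemma compact_operatorP H (T : H -> H) :
  compact_operator T <-> ultra_cauchy T.
Proof. by split; [exact: compact_ultra_cauchy|exact: ultra_cauchy_compact]. Qed.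

(** * Sums and composites of compact and bounded maps *)

Definition bounded_map H K (T : H -> K) : Prop :=
  exists2 c : R, 0 < c & forall x, rnorm (T x) <= c * rnorm x.

Lemma ultra_cauchyD H K (S T : H -> K) :
  ultra_cauchy S -> ultra_cauchy T -> ultra_cauchy (fun x => S x + T x).
Proof.
move=> Sc Tc F FU FB e e0.
have e20 : 0 < e / 2 by rewrite divr_gt0.
have [A FA AS] := Sc F FU FB _ e20.
have [C FC CT] := Tc F FU FB _ e20.
exists (A `&` C); first exact: filterI.
move=> x y [Ax Cx] [Ay Cy]; rewrite opprD addrACA.
apply: le_lt_trans (rnormD _ _) _.
have := AS x y Ax Ay; have := CT x y Cx Cy; lra.
Qed.

Lemma ultra_cauchyN H K (T : H -> K) :
  ultra_cauchy T -> ultra_cauchy (fun x => - T x).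
Proof.
move=> Tc F FU FB e e0; have [A FA AT] := Tc F FU FB e e0.
by exists A => // x y Ax Ay; rewrite -opprD rnormN; exact: AT.
Qed.

Lemma linear_fun0 H K (T : H -> K) : linear T -> T 0 = 0.
Proof.
by move=> Tlin; rewrite -[0 in LHS](subrr 0) -[- 0]scaleN1r addrC Tlin
  scaleN1r addNr.
Qed.

Lemma linear_funB H K (T : H -> K) : linear T -> {morph T : u v / u - v}.
Proof. by move=> Tlin u v; rewrite -scaleN1r addrC Tlin scaleN1r addrC. Qed.

Lemma linear_funD H K (T : H -> K) : linear T -> {morph T : u v / u + v}.
Proof. by move=> Tlin u v; rewrite -[u]scale1r Tlin !scale1r. Qed.

Lemma linear_funZ H K (T : H -> K) a u : linear T -> T (a *: u) = a *: T u.
Proof. by move=> Tlin; rewrite -[a *: u]addr0 Tlin linear_fun0// addr0. Qed.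

Lemma ultra_cauchy_compl H K L (S : K -> L) (T : H -> K) :
  linear S -> bounded_map S -> ultra_cauchy T -> ultra_cauchy (S \o T).
Proof.
move=> Slin [c c0 Sc] Tc F FU FB e e0.
have [A FA AT] := Tc F FU FB (e / c) (divr_gt0 e0 c0).
exists A => // x y Ax Ay /=; rewrite -linear_funB//.
apply: le_lt_trans (Sc _) _; rewrite mulrC -ltr_pdivlMr//; exact: AT.
Qed.

Lemma ultra_cauchy_compr H K L (S : K -> L) (T : H -> K) :
  linear S -> linear T -> bounded_map T -> ultra_cauchy S ->
  ultra_cauchy (S \o T).
Proof.
move=> Slin Tlin [c c0 Tc] Sc F FU FB e e0.
(* Rescaling by the bound of [T] keeps the image of the unit ball inside the unit ball, so the
   hypothesis on [S] applies to the pushed-forward ultrafilter. *)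
pose T' x := c^-1%:C *: T x.
have FB' : (T' @ F) (@unit_ball K).
  apply: (filterS (F := F) _ FB) => x /= Bx.
  rewrite /unit_ball /= rnormZ gtr0_norm ?invr_gt0// mulrC ler_pdivrMr// mul1r.
  apply: le_trans (Tc x) _; rewrite -[leRHS]mulr1 ler_pM2l//; exact: Bx.
have [A FA AS] := Sc _ (ultra_map T' FU) FB' (e / c) (divr_gt0 e0 c0).
exists (T' @^-1` A) => // x y Ax Ay /=.
have := AS _ _ Ax Ay.
rewrite /T' !(linear_funZ _ _ Slin) -scalerBr rnormZ gtr0_norm ?invr_gt0//.
by rewrite mulrC ltr_pM2r ?invr_gt0.
Qed.

(** * Adjointness as a relation between maps of two possibly different spaces *)

Definition adjoint_pair H K (T : H -> K) (S : K -> H) : Prop :=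
  forall x y, hdot K (T x) y = hdot H x (S y).

Lemma hdot_inj H (u v : H) : (forall x, hdot H x u = hdot H x v) -> u = v.
Proof.
move=> uv; apply/eqP; rewrite -subr_eq0 -normr_eq0 -sqrf_eq0 -hdotxx.
by rewrite linearBr/= uv subrr.
Qed.

Lemma adjoint_pairC H K (T : H -> K) (S : K -> H) :
  adjoint_pair T S -> adjoint_pair S T.
Proof. by move=> TS x y; rewrite hdotC -TS -hdotC. Qed.

Lemma adjoint_pair_linear H K (T : H -> K) (S : K -> H) :
  adjoint_pair T S -> linear S.
Proof.
move=> TS a u v; apply: hdot_inj => x.
by rewrite -TS !linearDr/= !linearZr_LR/= !TS.
Qed.

Lemma hdot_rnorm_le H (u v : H) : `|hdot H u v| <= (rnorm u * rnorm v)%:C.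
Proof. by rewrite rmorphM/= -!rnormE hdot_norm_le. Qed.

(** Cauchy-Schwarz applied to [<T x, T x> = <x, S (T x)>]. *)
Lemma rnorm_sqr_le H K (T : H -> K) (S : K -> H) x :
  adjoint_pair T S -> rnorm (T x) ^+ 2 <= rnorm (S (T x)) * rnorm x.
Proof.
move=> TS; rewrite -lecR [(_ ^+ 2)%:C]rmorphXn/= -rnormE -hdotxx TS.
rewrite mulrC; apply: le_trans (hdot_rnorm_le _ _).
by rewrite -TS hdotxx normrX normr_id.
Qed.

(** From [|S y|^2 <= |T (S y)| |y| <= c |S y| |y|], cancel [|S y|] when it is nonzero. *)
Lemma adjoint_pair_bounded H K (T : H -> K) (S : K -> H) :
  adjoint_pair T S -> bounded_map T -> bounded_map S.
Proof.
move=> TS [c c0 Tc]; exists c => // y.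
have := rnorm_sqr_le y (adjoint_pairC TS).
have := Tc (S y); have := rnorm_ge0 (S y); have := rnorm_ge0 y.
move: (rnorm _) (rnorm _) (rnorm _) => a b d a0 b0 db bda.
have [->|bn0] := eqVneq b 0; first by rewrite mulr_ge0// ltW.
have bp : 0 < b by rewrite lt0r bn0.
rewrite -(ler_pM2r bp) -expr2; apply: le_trans bda _.
by rewrite mulrAC ler_wpM2r.
Qed.

(** [rnorm_sqr_le] at [x - y] controls [T] by [S \o T] on differences. *)
Lemma ultra_cauchy_adjoint_comp H K (T : H -> K) (S : K -> H) :
  adjoint_pair T S -> ultra_cauchy (S \o T) -> ultra_cauchy T.
Proof.
move=> TS STc F FU FB e e0.
have Tlin := adjoint_pair_linear (adjoint_pairC TS).
have Slin := adjoint_pair_linear TS.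
(* The bound on [|T (x - y)|^2] carries the factor [|x - y|], which is at most 2 on the unit
   ball. *)
have e20 : 0 < e ^+ 2 / 2 by rewrite divr_gt0// exprn_gt0.
have [A FA AT] := STc F FU FB _ e20.
exists (A `&` @unit_ball H); first exact: filterI.
move=> x y [Ax Bx] [Ay By].
rewrite -ltr_sqr ?nnegrE ?rnorm_ge0 ?(ltW e0)// -linear_funB//.
apply: le_lt_trans (rnorm_sqr_le _ TS) _.
have := AT x y Ax Ay; rewrite /= -!linear_funB// => h1.
have h2 : rnorm (x - y) <= 2.
  apply: le_trans (rnormD _ _) _; rewrite rnormN.
  by move: Bx By; rewrite /unit_ball /=; lra.
have := rnorm_ge0 (x - y); have := rnorm_ge0 (S (T (x - y))).
move: h1 h2; move: (rnorm _) (rnorm _) => a b; nra.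
Qed.

(** Compactness of [S \o T] passes to [T], and then to [T \o S] because [S] is bounded. *)
Lemma ultra_cauchy_adjoint_swap H K (T : H -> K) (S : K -> H) :
  adjoint_pair T S -> bounded_map T ->
  ultra_cauchy (S \o T) -> ultra_cauchy (T \o S).
Proof.
move=> TS Tb STc; apply: ultra_cauchy_compr.
- exact: adjoint_pair_linear (adjoint_pairC TS).
- exact: adjoint_pair_linear TS.
- exact: adjoint_pair_bounded TS Tb.
- exact: ultra_cauchy_adjoint_comp TS STc.
Qed.

Lemma bounded_operator_map H (T : H -> H) : bounded_operator T -> bounded_map T.
Proof.
(* The maximum makes the constant positive, as [bounded_map] asks so that estimates can divide by
   it. *)
move=> [c Tc]; exists (Num.max c 1); first by rewrite lt_max ltr01 orbT.
move=> x; have := Tc x; rewrite !rnormE -rmorphM lecR => /le_trans; apply.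
by rewrite ler_wpM2r ?rnorm_ge0// le_max lexx.
Qed.

(** Links the relation to the chosen value [adjoint]: [S y] witnesses that the choice succeeds, and
    nondegeneracy makes the chosen vector unique. *)
Lemma adjoint_adjoint_pair H (T S : H -> H) : adjoint_pair T S -> adjoint T = S.
Proof.
move=> TS; apply/funext => y; apply: hdot_inj => x.
rewrite -TS; apply/esym.
have : exists z, forall x, hdot H (T x) y = hdot H x z by exists (S y).
by move/(xgetPex (0 : H)); exact.
Qed.

Lemma adjoint_pair_adjoint H (T : H -> H) :
  linear T -> bounded_operator T -> adjoint_pair T (adjoint T).
Proof. by move=> Tlin Tb x y; exact: adjointP. Qed.

Lemma bounded_map_comp H K L (S : K -> L) (T : H -> K) :
  bounded_map S -> bounded_map T -> bounded_map (S \o T).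
Proof.
move=> [c c0 Sc] [d d0 Td]; exists (c * d); first exact: mulr_gt0.
by move=> x /=; apply: le_trans (Sc _) _; rewrite -mulrA ler_pM2l.
Qed.

End UltraCauchy.

(** * Inclusion of a closed subspace and projection onto it *)

Section Compression.
Context (R : realType) (H : hilbertSpace R) (S : closedSubspace H).

(** [incl] and [proj] retype [val] and [orthproj] as maps between Hilbert spaces, to which
    [adjoint_pair] and [ultra_cauchy] apply. *)
Definition incl (u : subHilbert S) : H := val u.
Definition proj (x : H) : subHilbert S := orthproj S x.

Lemma incl_linear : linear incl.
Proof. by []. Qed.

(** The residual [x - proj x] is orthogonal to the subspace. Linearity and boundedness of [proj]
    follow from this adjointness. *)
Lemma incl_proj_adjoint : adjoint_pair incl proj.
Proof.
move=> u x; have := orthprojP x (set_mem (valP u)).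
rewrite linearBl /= => /eqP; rewrite subr_eq0 => /eqP xu.
by rewrite hdotC [hdot H x _]xu -hdotC.
Qed.

Lemma incl_bounded : bounded_map incl.
Proof. by exists 1 => // u; rewrite mul1r. Qed.

Lemma proj_linear : linear proj.
Proof. exact: adjoint_pair_linear incl_proj_adjoint. Qed.

Lemma proj_bounded : bounded_map proj.
Proof. exact: adjoint_pair_bounded incl_proj_adjoint incl_bounded. Qed.

Lemma inclK : cancel incl proj.
Proof. by move=> u; apply: hdot_inj => v; rewrite -incl_proj_adjoint. Qed.

Lemma ultra_cauchy_compression (T : H -> H) :
  linear T -> ultra_cauchy T -> ultra_cauchy (fun u => proj (T (incl u))).
Proof.
move=> Tlin Tc.
apply: (ultra_cauchy_compl proj_linear proj_bounded (T := T \o incl)).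
exact: ultra_cauchy_compr incl_linear incl_bounded Tc.
Qed.

End Compression.
Arguments incl_bounded {R H} S.
Arguments incl_proj_adjoint {R H} S.
Arguments proj_linear {R H} S.
Arguments proj_bounded {R H} S.
Arguments ultra_cauchy_compression {R H} S.

(** The residual of the projection onto [S] lies in the complement, and differs from [x] by a vector
    of [S], so it is the projection onto the complement. *)
Lemma incl_proj_orthocompl (R : realType) (H : hilbertSpace R)
    (S : closedSubspace H) (x : H) :
  incl (proj S x) + incl (proj (orthocompl_space S) x) = x.
Proof.
have xQ : x - incl (proj S x) \in (orthocompl_space S : set H).
  by apply/mem_set => s; exact: orthprojP.
suff -> : proj (orthocompl_space S) x =
    (Sub (x - incl (proj S x)) xQ : subspace_type (orthocompl_space S)).
  by rewrite /incl SubK addrC subrK.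
apply: orthproj_uniq => s Qs; rewrite SubK opprB addrC subrK.
by apply: hdot_eq0C; apply: Qs; exact/set_mem/valP.
Qed.

(** * Block form of the action and of its self-commutator *)

Section BlockDecomposition.
Context (R : realType) (A : complexAlgebra R) (M : hilbertModule A).
Context (N : hilbertSubmodule M) (a : A).

Let Q := orthocompl_space (submod_space N).
Let T : M -> M := hmod_act M a.
Let Ts : M -> M := adjoint T.
Let TN : subHilbert N -> subHilbert N := hmod_act (submodule N) a.
Let TQ : subHilbert Q -> subHilbert Q := hmod_act (quotient N) a.

(* T = [[TN, corner], [0, TQ]] with respect to M = N + Q. *)
Definition corner (g : subHilbert Q) : subHilbert N := proj N (T (incl g)).
Definition corner_adj (f : subHilbert N) : subHilbert Q := proj Q (Ts (incl f)).

Let Tlin : linear T.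
Proof. by move=> c u v; rewrite /T linearDr linearZr_LR. Qed.

Let TsP : adjoint_pair T Ts.
Proof. exact: adjoint_pair_adjoint Tlin (hmod_act_bounded M a). Qed.

Let Tslin : linear Ts := adjoint_pair_linear TsP.

Lemma self_commutator_linear : linear (self_commutator T).
Proof.
move=> c u v; rewrite /self_commutator -/Ts !(Tlin, Tslin) scalerBr opprD.
by rewrite addrACA.
Qed.

(** The adjoint of a composite is the reversed composite of adjoints. *)
Lemma corner_adjoint : adjoint_pair corner corner_adj.
Proof.
move=> g f.
rewrite (adjoint_pairC (incl_proj_adjoint N)) TsP.
exact: incl_proj_adjoint.
Qed.

Lemma corner_bounded : bounded_map corner.
Proof.
apply: (bounded_map_comp (proj_bounded N) (T := T \o @incl _ _ Q)).
apply: bounded_map_comp (incl_bounded Q).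
exact/bounded_operator_map/hmod_act_bounded.
Qed.

(** [TN] is the restriction of [T] to an invariant subspace, so its adjoint is the compression of
    [Ts]. *)
Lemma adjoint_sub_act : adjoint TN = fun f => proj N (Ts (incl f)).
Proof.
apply: adjoint_adjoint_pair => x y.
by rewrite -incl_proj_adjoint -TsP.
Qed.

Lemma adjoint_quot_act : adjoint TQ = fun g => proj Q (Ts (incl g)).
Proof.
apply: adjoint_adjoint_pair => x y.
rewrite (adjoint_pairC (incl_proj_adjoint Q)) TsP.
exact: incl_proj_adjoint.
Qed.

(** Invariance of [N] under [T] makes [Q] invariant under [Ts], so no projection appears. Here
    invariance enters through [quot_projM]. *)
Lemma incl_adjoint_quot_act g : incl (adjoint TQ g) = Ts (incl g).
Proof.
apply: hdot_inj => x; rewrite -TsP.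
have TQP : adjoint_pair TQ (adjoint TQ).
  apply: adjoint_pair_adjoint; last exact: (hmod_act_bounded (quotient N) a).
  by move=> c u v; rewrite /TQ linearDr linearZr_LR.
rewrite -(adjoint_pairC (incl_proj_adjoint Q)) -TQP.
rewrite -(adjoint_pairC (incl_proj_adjoint Q)); congr (hdot _ _ _).
exact/esym/quot_projM.
Qed.

Lemma self_commutator_sub f :
  self_commutator TN f =
  proj N (self_commutator T (incl f)) + corner (corner_adj f).
Proof.
rewrite /self_commutator -/Ts adjoint_sub_act /corner /corner_adj.
rewrite (linear_funB (proj_linear N)) -addrA; congr (_ + _).
(* Splitting [Ts f] into its [N] and [Q] components gives [TN (adjoint TN f)] and the corner
   term. *)
rewrite -[in T (Ts _)](incl_proj_orthocompl N (Ts (incl f))).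
rewrite (linear_funD Tlin) (linear_funD (proj_linear N)) opprD addrNK; congr (- _).
by rewrite -[LHS]inclK.
Qed.

Lemma self_commutator_quot g :
  self_commutator TQ g =
  proj Q (self_commutator T (incl g)) - corner_adj (corner g).
Proof.
rewrite /self_commutator -/Ts (linear_funB (proj_linear Q)).
have -> : TQ (adjoint TQ g) = proj Q (T (Ts (incl g))).
  by rewrite -incl_adjoint_quot_act.
rewrite addrAC; congr (_ - _).
(* Here [T g] is split: its [N] component yields the corner term, its [Q] component is [TQ g]. *)
rewrite -[in Ts (T _)](incl_proj_orthocompl N (T (incl g))).
rewrite (linear_funD Tslin) (linear_funD (proj_linear Q)).
by rewrite adjoint_quot_act addrC addKr.
Qed.

Lemma compact_sub_corner : compact_operator (self_commutator T) ->
  compact_operator (self_commutator TN) <-> ultra_cauchy (corner \o corner_adj).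
Proof.
rewrite !compact_operatorP => /(ultra_cauchy_compression N).
move=> /(_ self_commutator_linear) Dc; split=> [Nc|Ec].
  have -> : corner \o corner_adj = fun f => self_commutator TN f +
      - proj N (self_commutator T (incl f)).
    by apply/funext => f; rewrite self_commutator_sub addrC addKr.
  exact/ultra_cauchyD/ultra_cauchyN.
rewrite (funext self_commutator_sub); exact: ultra_cauchyD.
Qed.

Lemma compact_quot_corner : compact_operator (self_commutator T) ->
  compact_operator (self_commutator TQ) <-> ultra_cauchy (corner_adj \o corner).
Proof.
rewrite !compact_operatorP => /(ultra_cauchy_compression Q).
move=> /(_ self_commutator_linear) Dc; split=> [Qc|Ec].
  have -> : corner_adj \o corner = fun g =>
      proj Q (self_commutator T (incl g)) + - self_commutator TQ g.
    by apply/funext => g; rewrite self_commutator_quot subKr.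
  exact/ultra_cauchyD/ultra_cauchyN.
by rewrite (funext self_commutator_quot); exact/ultra_cauchyD/ultra_cauchyN.
Qed.

Lemma compact_sub_quot : compact_operator (self_commutator T) ->
  compact_operator (self_commutator TN) <-> compact_operator (self_commutator TQ).
Proof.
move=> Tc; rewrite compact_sub_corner// compact_quot_corner//.
have EP := corner_adjoint; have Eb := corner_bounded.
(* The two directions apply the swap to [corner_adj] and to [corner] respectively. *)
split; last exact: ultra_cauchy_adjoint_swap.
apply: ultra_cauchy_adjoint_swap; first exact: adjoint_pairC.
exact: adjoint_pair_bounded EP Eb.
Qed.

End BlockDecomposition.

Theorem theorem1 (R : realType) (A : complexAlgebra R) (M : hilbertModule A)
    (N : hilbertSubmodule M) :
  essentially_reductive M ->
  (essentially_reductive (submodule N) <-> essentially_reductive (quotient N)).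
Proof.
move=> Mred; split=> Xred a; have [NQ QN] := compact_sub_quot N (Mred a).
  exact/NQ/Xred.
exact/QN/Xred.
Qed.
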